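(* Let $(X,d)$ be a metric space, let $T:X\rightarrow CB(X)$ be a multivalued integral type $F_{C}$-contraction with $x_{0}\in X$, and let $$r=\inf \left\{ H(Tx,\{x\}): x\in X,\ H(Tx,\{x\})>0\right\}.$$ Then the circle $C_{x_{0},r}$ is a fixed circle of $T$.
   Context: For a metric space $(X,d)$, $CB(X)$ is the family of all nonempty, closed and bounded subsets of $X$. For $x\in X$ and $B\in CB(X)$, $D(x,B)=\inf\{d(x,y):y\in B\}$, and for $A,B\in CB(X)$, $H(A,B)=\max\{\sup_{x\in A}D(x,B),\sup_{y\in B}D(y,A)\}$ is the Hausdorff metric induced by $d$. The circle is $C_{x_{0},r}=\{x\in X:d(x,x_{0})=r\}$. A circle $C_{x_{0},r}$ is a fixed circle of $T:X\to CB(X)$ if $x\in Tx$ for each $x\in C_{x_{0},r}$. $\mathcal{F}$ is the family of all functions $F:(0,\infty)\to\mathbb{R}$ such that: (F1) $F$ is strictly increasing; (F2) for each sequence $\{\alpha_n\}$ in $(0,\infty)$, $\lim_{n\to\infty}\alpha_n=0$ if and only if $\lim_{n\to\infty}F(\alpha_n)=-\infty$; (F3) there exists $k\in(0,1)$ with $\lim_{\alpha\to0^+}\alpha^kF(\alpha)=0$. Let $\varphi:[0,\infty)\to[0,\infty)$ be a (non-negative) Lebesgue-integrable mapping which is summable (has finite integral) on each compact subset of $[0,\infty)$ and satisfies $\int_0^\varepsilon\varphi(t)\,dt>0$ for each $\varepsilon>0$. $T:X\to CB(X)$ is a multivalued integral type $F_{C}$-contraction with $x_0\in X$ if there exist $F\in\mathcal{F}$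 and $\tau>0$ such that for all $x\in X$: $H(Tx,\{x\})>0$ implies $\tau+F\left(\int_0^{H(Tx,\{x\})}\varphi(t)\,dt\right)\leq F\left(\int_0^{d(x,x_{0})}\varphi(t)\,dt\right)$. Since $F$ is defined only on $(0,\infty)$, the inequality is understood to include the requirement that its right-hand side is defined, i.e. $d(x,x_0)>0$. *)

(* Defs.v *)
From HB Require Import structures.
From mathcomp Require Import all_boot all_order all_algebra.
From mathcomp Require Import all_classical all_reals all_analysis.

Set Implicit Arguments.
Unset Strict Implicit.
Unset Printing Implicit Defensive.

Import Order.TTheory GRing.Theory Num.Theory.
Import numFieldNormedType.Exports.

Local Open Scope classical_set_scope.
Local Open Scope ring_scope.

Definition mbounded (R : realType) (X : metricType R) (A : set X) : Prop :=
  exists M : R, forall x y, A x -> A y -> mdist x y <= M.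

Definition CB (R : realType) (X : metricType R) : set (set X) :=
  [set A | [/\ A !=set0, closed A & mbounded A]].

Definition point_dist (R : realType) (X : metricType R) (x : X) (B : set X) : R :=
  inf [set mdist x y | y in B].

(* [inf] and [sup] are junk-valued on empty or unbounded sets: this is the
   Hausdorff metric only for [A] and [B] in [CB]. *)
Definition hausdorff (R : realType) (X : metricType R) (A B : set X) : R :=
  Num.max (sup [set point_dist x B | x in A]) (sup [set point_dist y A | y in B]).

Definition circle (R : realType) (X : metricType R) (x0 : X) (r : R) : set X :=
  [set x | mdist x x0 = r].

Definition fixed_circle (R : realType) (X : metricType R) (T : X -> set X)
    (x0 : X) (r : R) : Prop :=
  forall x, circle x0 r x -> T x x.

(* A function on (0, oo) is a total function of which only the values at
   positive reals are constrained; [0^'+] only sees those values. *)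
Definition F_family (R : realType) (F : R -> R) : Prop :=
  [/\ forall a b : R, 0 < a -> a < b -> F a < F b,
      forall u : nat -> R, (forall n, 0 < u n) ->
        (u n @[n --> \oo] --> (0 : R)) <-> (F (u n) @[n --> \oo] --> -oo)
    & exists k : R, [/\ 0 < k, k < 1 & a `^ k * F a @[a --> 0^'+] --> (0 : R)]].

(* The completed measure is used so that [phi] may be any Lebesgue-measurable
   function; [lebesgue_measure] only has Borel-measurable ones. *)
Definition int0 (R : realType) (phi : R -> R) (a : R) : R :=
  \int[completed_lebesgue_measure]_(t in `[0, a]) phi t.

Definition admissible_integrand (R : realType) (phi : R -> R) : Prop :=
  [/\ forall t : R, 0 <= t -> 0 <= phi t,
      forall K : set R, compact K -> K `<=` `[0, +oo[ ->
        (@completed_lebesgue_measure R).-integrable K (EFin \o phi)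
    & forall e : R, 0 < e -> 0 < int0 phi e].

(* The conjunct [0 < mdist x x0] says that the right-hand side of the
   inequality is defined, [F] being a function on (0, oo). *)
Definition integral_FC_contraction (R : realType) (X : metricType R)
    (phi : R -> R) (T : X -> set X) (x0 : X) : Prop :=
  exists (F : R -> R) (tau : R), [/\ F_family F, 0 < tau &
    forall x, 0 < hausdorff (T x) [set x] ->
      0 < mdist x x0 /\
      tau + F (int0 phi (hausdorff (T x) [set x])) <= F (int0 phi (mdist x x0))].

(* Main.v *)
Require Import Defs.
From mathcomp Require Import all_boot all_order all_algebra.
From mathcomp Require Import all_classical all_reals all_analysis.

Import Order.TTheory GRing.Theory Num.Theory.

Local Open Scope classical_set_scope.
Local Open Scope ring_scope.

(** Let [x] lie on the circle of radius [r], and suppose that [H(Tx, {x}) > 0].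
    Then [r <= H(Tx, {x})] by definition of [r], while [d(x, x0) = r] is
    positive; as the integral of [phi] and [F] are monotone, this gives
    [F(int_0^r phi) <= F(int_0^H phi)], against the contraction inequality with
    [tau > 0].  So [H(Tx, {x}) = 0], which puts [x] in the closure of [Tx]. *)

(** An infimum at most 0 is approached by points of [A] in every ball around [x]. *)
Lemma closed_point_dist_le0 (R : realType) (X : metricType R) (x : X)
    (A : set X) : A !=set0 -> closed A -> point_dist x A <= 0 -> A x.
Proof.
move=> [a Aa] A_closed dxA; apply: A_closed => B /nbhs_ballP[e /= e0 eB].
have has_dist : has_inf [set mdist x y | y in A].
  by split; [exists (mdist x a), a|exists 0 => _ [y _ <-]; exact: mdist_ge0].
have [_ [y Ay <-] xy] := inf_adherent e0 has_dist.
exists y; split => //; apply: eB.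
by rewrite ballEmdist/= (lt_le_trans xy)// gerDr.
Qed.

(** The second supremum in [hausdorff] runs over the single point [x]. *)
Lemma le_point_dist_hausdorff (R : realType) (X : metricType R) (x : X)
    (A : set X) : point_dist x A <= hausdorff A [set x].
Proof. by rewrite /hausdorff image_set1 sup1 le_max lexx orbT. Qed.

Lemma le_int0 (R : realType) (phi : R -> R) (a b : R) :
  admissible_integrand phi -> a <= b -> int0 phi a <= int0 phi b.
Proof.
move=> [phi0 phi_int _] ab.
have int_phi c : (@completed_lebesgue_measure R).-integrable `[0, c]
    (EFin \o phi).
  apply: phi_int; first exact: segment_compact.
  by move=> t; rewrite /= !in_itv/= andbT => /andP[].
(* The completed measure lives on the Carathéodory sigma-algebra, which contains the intervals. *)
have measurable_itv0 (c : R) :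
    ((wlength (@idfun R))^*%mu).-cara.-measurable [set` `[0, c]].
  by apply: sub_caratheodory; exact: measurable_itv.
apply: fine_le; [exact: integrable_fin_num|exact: integrable_fin_num|].
apply: ge0_subset_integral => //.
- exact: measurable_int (int_phi b).
- by move=> t; rewrite /= in_itv/= => /andP[t0 _]; rewrite lee_fin phi0.
- by move=> t; rewrite /= !in_itv/= => /andP[-> /le_trans ->].
Qed.

Theorem theorem2p2 (R : realType) (X : metricType R) (phi : R -> R)
    (hphi : admissible_integrand phi)
    (T : X -> set X) (hT : forall x, CB (T x)) (x0 : X)
    (hF : integral_FC_contraction phi T x0) :
  fixed_circle T x0
    (inf [set hausdorff (T x) [set x] | x in
           [set x | 0 < hausdorff (T x) [set x]]]).
Proof.
set S := (X in inf X); move=> x xr.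
have [F [tau [[F_incr _ _] tau0 contr]]] := hF.
have [Tx0 Tx_closed _] := hT x.
apply: closed_point_dist_le0 => //.
apply: le_trans (le_point_dist_hausdorff _ _ _ _) _.
rewrite leNgt; apply/negP => H0.
have [d0 Fle] := contr x H0.
have dH : mdist x x0 <= hausdorff (T x) [set x].
  (* By [H0], the value at [x] belongs to the set [S], which 0 bounds below. *)
  rewrite xr; apply: ge_inf; last by exists x.
  by exists 0 => _ [y /ltW ? <-].
have int0_gt0 : 0 < int0 phi (mdist x x0) by case: hphi => _ _; apply.
have Fge : F (int0 phi (mdist x x0)) <= F (int0 phi (hausdorff (T x) [set x])).
  (* The integrals may coincide, as [phi] may vanish between the bounds; [F_incr] covers only the
     strict case. *)
  have := le_int0 _ phi _ _ hphi dH; rewrite le_eqVlt => /predU1P[-> //|].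
  by move=> /(F_incr _ _ int0_gt0)/ltW.
have := le_trans Fle Fge.
by rewrite gerDr leNgt tau0.
Qed.
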